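(* Let $X$ be a reflexive Banach space which is either separable or locally uniformly convex. Let $Y\subseteq X$ be the closure of the union of a directed family $(Y_i)_{i\in I}$ of subspaces of $X$. Then $$\mathrm{Env}(Y)=\overline{\bigcup_{i\in I}\mathrm{Env}(Y_i)}.$$
   Context: A family $(Y_i)_{i\in I}$ of subspaces is directed if $I$ is a directed set and $Y_i\subseteq Y_j$ whenever $i\le j$. The isometric envelope $\mathrm{Env}(Y)$ of a subspace $Y$ of $X$ is the set of $x\in X$ such that whenever a net $(T_j)_{j}$ of surjective linear isometries of $X$ satisfies $T_j y\to y$ for every $y\in Y$, then $T_j x\to x$ (norm convergence). $X$ is locally uniformly convex if for every $x_0$ in the unit sphere and $\varepsilon>0$ there is $\delta>0$ such that for all $x$ in the unit ball, $\|\frac{x+x_0}{2}\|>1-\delta$ implies $\|x-x_0\|<\varepsilon$. *)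

(* Defs.v *)
From HB Require Import structures.
From mathcomp Require Import all_boot all_order all_algebra.
From mathcomp Require Import complex.
From mathcomp Require Import all_classical all_reals all_analysis.
Set Implicit Arguments.
Unset Strict Implicit.
Unset Printing Implicit Defensive.
Import Order.TTheory GRing.Theory Num.Theory.
Import numFieldNormedType.Exports.
Local Open Scope classical_set_scope.
Local Open Scope ring_scope.

(* Banach spaces are real or complex: a Banach space is a
   completeNormedModType K with real_or_complex R K. *)
Variant real_or_complex (R : realType) : numFieldType -> Prop :=
  | real_scalars : real_or_complex R R
  | complex_scalars : real_or_complex R R[i].

Section dual.
Variables (K : numFieldType) (X : normedModType K).

Definition dual_pred : {pred X -> K^o} :=
  fun f => `[< linear f /\ continuous f >].

Lemma dual_pred_submod_closed : submod_closed dual_pred.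
Proof.
split=> [|a f g /asboolP[lf cf] /asboolP[lg cg]]; apply/asboolP; split.
- by move=> b x y; rewrite [RHS]addr0 scaler0.
- exact: (@cst_continuous X K^o 0).
- move=> b x y; rewrite -[LHS]/(a *: f (b *: x + y) + g (b *: x + y)).
  by rewrite lf lg !scalerDr !scalerA (mulrC a b) addrACA.
- by move=> x; apply: cvgD; [apply: cvgZr; exact: cf|exact: cg].
Qed.

HB.instance Definition _ :=
  GRing.isSubmodClosed.Build K (X -> K^o) dual_pred dual_pred_submod_closed.

Record dual := Dual { dual_val :> X -> K^o; _ : dual_val \in dual_pred }.

HB.instance Definition _ := [isSub for dual_val].
HB.instance Definition _ := [Choice of dual by <:].
HB.instance Definition _ := [SubChoice_isSubLmodule of dual by <:].

(* The norm of X is K-valued, so the operator norm is the least M : K with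
   `|f x| <= M * `|x| for all x. It exists for K = R and K = R[i]; the
   default value 0 of xget is then never used. *)
Definition is_operator_norm (f : dual) (M : K) : Prop :=
  [/\ 0 <= M, forall x, `|f x| <= M * `|x| &
      forall M', 0 <= M' -> (forall x, `|f x| <= M' * `|x|) -> M <= M'].

Definition operator_norm (f : dual) : K := xget 0 (is_operator_norm f).

(* Every bounded linear functional on the dual is an evaluation. *)
Definition reflexive_space : Prop :=
  forall phi : {linear dual -> K^o},
    (exists C : K, forall f, `|phi f| <= C * operator_norm f) ->
    exists x : X, forall f : dual, phi f = f x.

End dual.

Definition separable_space (T : topologicalType) : Prop :=
  exists2 D : set T, countable D & dense D.

Definition locally_uniformly_convex (K : numFieldType) (X : normedModType K) :
    Prop :=
  forall (x0 : X) (e : K), `|x0| = 1 -> 0 < e ->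
    exists2 d : K, 0 < d &
      forall x : X, `|x| <= 1 -> 1 - d < `|2^-1 *: (x + x0)| ->
        `|x - x0| < e.

(* Not assumed closed. *)
Definition linear_subspace (K : numFieldType) (X : normedModType K)
    (Y : set X) : Prop :=
  submod_closed [in Y].

(* Directed sets are nonempty preorders. *)
Definition directed_set (I : Type) (le : I -> I -> Prop) : Prop :=
  [/\ inhabited I,
      forall i, le i i,
      forall i j k, le i j -> le j k -> le i k &
      forall i j, exists2 k, le i k & le j k].

Definition directed_family (K : numFieldType) (X : normedModType K)
    (I : Type) (le : I -> I -> Prop) (Y : I -> set X) : Prop :=
  [/\ directed_set le, forall i, linear_subspace (Y i) &
      forall i j, le i j -> Y i `<=` Y j].

(* Convergence of a net is convergence along the filter of its tails. *)
Definition tails (J : Type) (le : J -> J -> Prop) : set_system J :=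
  [set A | exists j0, forall j, le j0 j -> A j].

Definition surjective_isometry (K : numFieldType) (X : normedModType K)
    (T : {linear X -> X}) : Prop :=
  (forall x, `|T x| = `|x|) /\ (forall y, exists x, T x = y).

Definition Env (K : numFieldType) (X : normedModType K) (Y : set X) : set X :=
  [set x | forall (J : Type) (le : J -> J -> Prop) (T : J -> {linear X -> X}),
     directed_set le ->
     (forall j, surjective_isometry (T j)) ->
     (forall y, Y y -> T j y @[j --> tails le] --> y) ->
     T j x @[j --> tails le] --> x].

(* Main.v *)
From HB Require Import structures.
Require Import Defs.
From mathcomp Require Import all_boot all_order all_algebra.
From mathcomp Require Import all_classical all_reals all_analysis.
From mathcomp Require Import complex ring lra.
Import Order.TTheory GRing.Theory Num.Theory.
Import numFieldNormedType.Exports.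
Local Open Scope classical_set_scope.
Local Open Scope ring_scope.
Set Implicit Arguments.
Unset Strict Implicit.
Unset Printing Implicit Defensive.

(** The inclusion of the closure in [Env Y] is formal: envelopes grow with the
    subspace and are closed, as isometries are equicontinuous.

    For the converse, let [x] be in [Env Y] and [d > 0]. By the definition of
    the envelope, finitely many points of [Y] and a tolerance decide whether an
    isometry moves [x] by at most [d]; these points are almost in a single
    [Yi i], so every isometry close enough to the identity on [Yi i] moves [x]
    by at most [d] ([near_identity_directed]). It remains to find a point of
    [Env (Yi i)] within [d] of [x] ([Env_near]).

    Such a point is a common fixed point of all weak limits of nets of
    isometries that tend to the identity on [Yi i]. A closed convex set
    containing the limits of the orbits of its points is called [stable]. The
    points whose orbits stay within [d] of [x] form a bounded stable set that
    contains [x], so weak compactness and the lemma of Zorn give a minimal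
    stable set [C] inside it. Fix [e > 0] and suppose that [C] lies in a set
    [E] invariant under all isometries, and that each [c] in [C] is cut off
    from [E] by a closed convex set [H] with [E] minus [H] of diameter at most
    [e]. Applied to the midpoint [c] of two points of [C], this says that one of
    these is [e]-close to [c], because [H] is convex. So [C] is a single point
    [z], all limits of whose orbit are [z]. The orbit is thus eventually
    outside [H], hence [e]-close to [z], so that weak convergence becomes norm
    convergence and [z] is in the envelope ([dentable_stable_Env]).

    The sets [E] come from convexity or from separability. If the norm is
    locally uniformly convex, minimality forces all points of [C] to have the
    same norm, and [E] is the ball of that radius ([LUC_envelope]). If the space
    is separable, [E] is the smallest closed convex invariant set containing
    [C]: its points without small slices form a closed convex invariant subset,
    which is proper since [E] is dentable ([separable_dentable]); by minimality
    of [C] this subset is disjoint from [C] ([dentable_stable_envelope]).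

    Reflexivity enters through one statement, [reflexive_weak_cluster]: a
    filter containing a bounded set has a point common to all its closed convex
    members. It is derived from the theorem of Hahn and Banach, for real and
    complex scalars at once. *)

(** * Closed convex sets *)

Section closed_convex.
Variables (K : numFieldType) (X : normedModType K).
Implicit Types (A B C H : set X).

Lemma closure_normP A (x : X) :
  closure A x <-> forall e : K, 0 < e -> exists2 a, A a & `|x - a| < e.
Proof.
split=> [cAx e e0|Ax B /nbhs_normP[e /= e0 eB]].
  have [a [Aa]] := cAx _ (nbhsx_ballx x e e0).
  by rewrite -ball_normE /= => xa; exists a.
have [a Aa xa] := Ax e e0.
by exists a; split => //; exact: eB.
Qed.

Lemma closed_normP A :
  closed A <->
  forall x, (forall e : K, 0 < e -> exists2 a, A a & `|x - a| < e) -> A x.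
Proof.
by split=> cA x; [move=> /closure_normP/cA|move=> /closure_normP; exact: cA].
Qed.

Lemma closed_norm_le (z : X) (m : K) : closed [set x : X | `|x - z| <= m].
Proof.
apply/closed_normP => x xP; apply/ler_addgt0Pr => e /xP[a /= am xa].
have -> : x - z = (a - z) + (x - a) by rewrite [RHS]addrC addrA subrK.
by rewrite (le_trans (ler_normD _ _))// lerD// ltW.
Qed.

Definition closed_convex C :=
  closed C /\
  forall u v (t : K), 0 <= t -> t <= 1 -> C u -> C v ->
    C (t *: u + (1 - t) *: v).

Definition norm_bounded A (M : K) := forall x, A x -> `|x| <= M.

Lemma closed_convex0 : closed_convex set0.
Proof. by split; first exact: closed0. Qed.

Lemma closed_convexT : closed_convex setT.
Proof. by split; first exact: closedT. Qed.

Lemma closed_convexI A B :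
  closed_convex A -> closed_convex B -> closed_convex (A `&` B).
Proof.
move=> [cA vA] [cB vB]; split; first exact: closedI.
by move=> u v t t0 t1 [Au Bu] [Av Bv]; split; [exact: vA|exact: vB].
Qed.

Lemma closed_convex_bigcap (I : Type) (D : set I) (F : I -> set X) :
  (forall i, D i -> closed_convex (F i)) ->
  closed_convex (\bigcap_(i in D) F i).
Proof.
move=> DF; split; first by apply: closed_bigI => i /DF[].
move=> u v t t0 t1 Fu Fv i Di.
by apply: (DF i Di).2 => //; [exact: Fu|exact: Fv].
Qed.

Lemma convex_combB (u v z : X) (t : K) :
  t *: u + (1 - t) *: v - z = t *: (u - z) + (1 - t) *: (v - z).
Proof.
rewrite !scalerBr addrACA; congr (_ + _).
by rewrite -opprD -scalerDl addrC subrK scale1r.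
Qed.

Lemma norm_convex_comb (u v : X) (t m : K) : 0 <= t -> t <= 1 ->
  `|u| <= m -> `|v| <= m -> `|t *: u + (1 - t) *: v| <= m.
Proof.
move=> t0 t1 um vm; rewrite (le_trans (ler_normD _ _))// !normrZ.
rewrite (ger0_norm t0) ger0_norm ?subr_ge0//.
have -> : m = t * m + (1 - t) * m by rewrite -mulrDl addrC subrK mul1r.
by rewrite lerD// ler_wpM2l// subr_ge0.
Qed.

Lemma closed_convex_ball (z : X) (m : K) :
  closed_convex [set x : X | `|x - z| <= m].
Proof.
split; first exact: closed_norm_le.
by move=> u v t t0 t1 /= um vm; rewrite convex_combB norm_convex_comb.
Qed.

Lemma closed_convex_closure A :
  (forall u v (t : K), 0 <= t -> t <= 1 -> A u -> A v ->
     A (t *: u + (1 - t) *: v)) ->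
  closed_convex (closure A).
Proof.
move=> vA; split; first exact: closed_closure.
move=> u v t t0 t1 /closure_normP Au /closure_normP Av.
apply/closure_normP => e e0.
have e20 : 0 < e / 2 by rewrite divr_gt0.
have [a Aa ua] := Au _ e20; have [b Ab vb] := Av _ e20.
exists (t *: a + (1 - t) *: b); first exact: vA.
rewrite opprD addrACA -!scalerBr (@le_lt_trans _ _ (e / 2))//.
  by apply: norm_convex_comb => //; exact: ltW.
by rewrite ltr_pdivrMr// ltr_pMr// ltr1n.
Qed.

Lemma closed_convex_preimage (T : {linear X -> X}) C :
  (forall x, `|T x| = `|x|) -> closed_convex C -> closed_convex (T @^-1` C).
Proof.
move=> Tiso [cC vC]; split; last first.
  by move=> u v t t0 t1 Cu Cv; rewrite /preimage/= linearD !linearZ; exact: vC.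
apply/closed_normP => x xP; move/closed_normP: cC; apply => e /xP[a Ca xa].
by exists (T a) => //; rewrite -linearB Tiso.
Qed.

End closed_convex.

(** * Isometries close to the identity on a set *)

Section near_identity.
Variables (K : numFieldType) (X : normedModType K).
Implicit Types (Y : set X) (A : set {linear X -> X}).

(** The filter of the neighbourhoods of the identity for the topology of
    pointwise norm convergence on [Y]. Nets only enter the proof through it. *)
Definition near_identity Y : set_system {linear X -> X} :=
  [set A | exists (s : seq X) (e : K),
     [/\ 0 < e, forall y, y \in s -> Y y &
         forall T, surjective_isometry T ->
           (forall y, y \in s -> `|T y - y| < e) -> A T]].

Lemma surjective_isometry_id : @surjective_isometry K X idfun.
Proof. by split => // y; exists y. Qed.

Lemma surjective_isometry_comp (S T : {linear X -> X}) :
  surjective_isometry S -> surjective_isometry T ->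
  surjective_isometry (S \o T).
Proof.
move=> [iS sS] [iT sT]; split=> [x|y] /=; first by rewrite iS iT.
by have [z <-] := sS y; have [x <-] := sT z; exists x.
Qed.

Lemma near_identity_id Y A : near_identity Y A -> A idfun.
Proof.
move=> [s [e [e0 _]]]; apply; first exact: surjective_isometry_id.
by move=> y _; rewrite subrr normr0.
Qed.

Lemma pos_lower_bound (a b : K) : 0 < a -> 0 < b ->
  exists c, [/\ 0 < c, c <= a & c <= b].
Proof.
move=> a0 b0; have [ab|/ltW ba] := real_leP (gtr0_real a0) (gtr0_real b0).
  by exists a.
by exists b.
Qed.

#[export] Instance near_identity_filter Y : ProperFilter (near_identity Y).
Proof.
split.
  by move=> /near_identity_id.
split.
- by exists [::], 1; split.
- move=> A B [s [e [e0 sY sA]]] [s' [e' [e'0 s'Y s'B]]].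
  have [c [c0 ce ce']] := pos_lower_bound e0 e'0.
  exists (s ++ s'), c; split=> //.
    by move=> y; rewrite mem_cat => /orP[/sY|/s'Y].
  move=> T Tiso Ty; split.
    by apply: sA => // y ys; rewrite (lt_le_trans _ ce)// Ty// mem_cat ys.
  by apply: s'B => // y ys; rewrite (lt_le_trans _ ce')// Ty// mem_cat ys orbT.
- move=> A B AB [s [e [e0 sY sA]]]; exists s, e; split=> // T Tiso Ty.
  exact/AB/sA.
Qed.

Lemma near_identity_isometry Y :
  near_identity Y [set T | surjective_isometry T].
Proof. by exists [::], 1; split. Qed.

(** The filter plays the part of a filter of neighbourhoods of the unit of a
    group: the product of two isometries that move a point by less than [e / 2]
    moves it by less than [e]. *)
Lemma near_identity_comp Y A : near_identity Y A ->
  near_identity Y [set T : {linear X -> X} |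
    near_identity Y [set S : {linear X -> X} | A (T \o S)]].
Proof.
move=> [s [e [e0 sY sA]]]; have e20 : 0 < e / 2 by rewrite divr_gt0.
exists s, (e / 2); split=> // T Tiso Ty.
exists s, (e / 2); split=> // S Siso Sy.
apply: sA; first exact: surjective_isometry_comp.
move=> y ys /=; have -> : T (S y) - y = T (S y - y) + (T y - y).
  by rewrite linearB addrA subrK.
rewrite (le_lt_trans (ler_normD _ _))// Tiso.1 (splitr e) ltrD//.
  exact: Sy.
exact: Ty.
Qed.

Lemma near_identity_sub Y Y' A : Y `<=` Y' ->
  near_identity Y A -> near_identity Y' A.
Proof.
move=> YY' [s [e [e0 sY sA]]]; exists s, e; split=> // y /sY; exact: YY'.
Qed.

(** A basic set of the filter involves finitely many points, and these can be
    approximated from one member of the family since it is directed. *)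
Lemma near_identity_directed (I : Type) (le : I -> I -> Prop)
    (Yi : I -> set X) A :
  directed_family le Yi -> near_identity (closure (\bigcup_i Yi i)) A ->
  exists i, near_identity (Yi i) A.
Proof.
move=> [[[i0] lexx le_trans le_dir] _ Yi_le] [s [e [e0 sY sA]]].
have e30 : 0 < e / 3 by rewrite divr_gt0.
(* by directedness the finitely many indices have a common upper bound *)
have [i iP] : exists i, forall y, y \in s ->
    exists2 z, Yi i z & `|y - z| < e / 3.
  elim: s sY {sA} => [|y s IHs] sY; first by exists i0.
  have [|i iP] := IHs.
    by move=> z zs; refine (sY z _); rewrite inE zs orbT.
  have /closure_normP/(_ _ e30)[z [j _ Yjz] yz] := sY y (mem_head _ _).
  have [k ik jk] := le_dir i j; exists k => w; rewrite inE => /orP[/eqP->|/iP].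
    by exists z => //; exact: (Yi_le _ _ jk).
  by move=> [u Yu wu]; exists u => //; exact: (Yi_le _ _ ik).
have /choice[f fP] : forall y, exists z, y \in s -> Yi i z /\ `|y - z| < e / 3.
  move=> y; have [/iP[z Yz yz]|/negP ys] := boolP (y \in s); last by exists 0.
  by exists z.
exists i, (map f s), (e / 3); split=> //.
  by move=> _ /mapP[y /fP[]? _ ->].
move=> T Tiso Tf; apply: sA => // y ys.
have -> : T y - y = T (y - f y) + ((T (f y) - f y) + (f y - y)).
  by rewrite linearB [T (f y) - f y + _]addrA !subrK addrA subrK.
have -> : e = e / 3 + (e / 3 + e / 3) by field.
rewrite (le_lt_trans (ler_normD _ _))// Tiso.1 ltrD ?(fP _ ys).2//.
rewrite (le_lt_trans (ler_normD _ _))// ltrD//; first exact/Tf/map_f.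
by rewrite distrC (fP _ ys).2.
Qed.

Lemma tails_filter (J : Type) (le : J -> J -> Prop) :
  directed_set le -> Filter (tails le).
Proof.
move=> [[j0] lexx le_trans le_dir]; split.
- by exists j0.
- move=> A B [a aA] [b bB]; have [c ac bc] := le_dir a b.
  by exists c => j cj; split; [apply: aA|apply: bB]; exact: le_trans cj.
- by move=> A B AB [a aA]; exists a => j /aA/AB.
Qed.

Lemma near_identity_Env Y x :
  (forall e : K, 0 < e -> near_identity Y [set T | `|T x - x| <= e]) -> Env Y x.
Proof.
move=> xP J le T le_dir Tiso TY; have tF := tails_filter le_dir.
apply/cvgrPdist_le => e /xP[s [d [d0 sY sA]]].
suff : tails le [set j | forall y, y \in s -> `|T j y - y| < d].
  by apply: filterS => j jP; rewrite distrC; exact: (sA _ (Tiso j)).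
elim: s sY {sA} => [|y s IHs] sY; first by near=> j.
have /cvgrPdist_lt/(_ d d0) := TY y (sY y (mem_head _ _)).
apply: filterS2 (IHs _) => [j js jy z|z zs].
  by rewrite inE => /orP[/eqP->|/js//]; rewrite distrC.
by refine (sY z _); rewrite inE zs orbT.
Unshelve. all: by end_near. Qed.

(** If the conclusion fails, choosing a bad isometry for each finite subset of
    [Y] and each tolerance defines a net that violates the hypothesis. *)
Lemma Env_near_identity Y x : Env Y x ->
  forall e : K, 0 < e -> near_identity Y [set T | `|T x - x| <= e].
Proof.
move=> xP e e0; apply: contrapT => nx.
pose Jp (p : seq X * K) := 0 < p.2 /\ forall y, y \in p.1 -> Y y.
pose J := {p | Jp p}.
have mkJ (s : seq X) (c : K) : 0 < c -> (forall y, y \in s -> Y y) ->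
    exists j : J, sval j = (s, c).
  by move=> c0 sY; exists (exist Jp (s, c) (conj c0 sY)).
pose le (p q : J) := {subset (sval p).1 <= (sval q).1} /\
  (sval q).2 <= (sval p).2.
have TP (p : J) : exists T : {linear X -> X}, [/\ surjective_isometry T,
    forall y, y \in (sval p).1 -> `|T y - y| < (sval p).2 & ~ `|T x - x| <= e].
  apply: contrapT => nT; apply: nx; have [p0 pY] := svalP p.
  exists (sval p).1, (sval p).2; split=> // T Tiso Ty /=.
  by apply: contrapT => nTx; apply: nT; exists T.
have [T {}TP] := choice TP.
have le_dir : directed_set le.
  split.
  - by constructor; exists ([::], 1).
  - by move=> p; split.
  - move=> p q r [pq qp] [qr rq]; split; first by move=> y /pq/qr.
    exact: le_trans rq qp.
  - move=> p q; have [[p0 pY] [q0 qY]] := (svalP p, svalP q).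
    have [c [c0 cp cq]] := pos_lower_bound p0 q0.
    have [||r rE] := mkJ ((sval p).1 ++ (sval q).1) c => //.
      by move=> y; rewrite mem_cat => /orP[/pY|/qY].
    by exists r; rewrite /le rE; split=> //= y ys; rewrite mem_cat ys ?orbT.
have tF := tails_filter le_dir.
have TY y : Y y -> T j y @[j --> tails le] --> y.
  move=> Yy; apply/cvgrPdist_lt => d d0.
  have [||r rE] := mkJ [:: y] d => //; first by move=> z; rewrite inE => /eqP->.
  exists r => j; rewrite /le rE => -[/= sj dj]; have [_ /(_ y) jy _] := TP j.
  by rewrite distrC (lt_le_trans _ dj)// jy// sj// mem_head.
have Tiso j : surjective_isometry (T j) by have [] := TP j.
have /cvgrPdist_le/(_ e e0)[j0 j0P] := xP J le T le_dir Tiso TY.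
have [_ lexx _ _] := le_dir; have [_ _] := TP j0; apply.
by rewrite distrC; exact: j0P.
Qed.

End near_identity.

(** * Stable sets and fixed points *)

Section stable_sets.
Variables (K : numFieldType) (X : normedModType K).
Implicit Types (Y C E H : set X).

(** Weak compactness of bounded sets, expressed without the weak topology. *)
Definition weak_cluster_property : Prop :=
  forall F : set_system X, ProperFilter F ->
    (exists2 B, F B & exists M, norm_bounded B M) ->
    exists p, forall C, closed_convex C -> F C -> C p.

(** The points [p] considered here include the weak limits of [T c] as the
    isometry [T] tends to the identity on [Y]; in a reflexive space they are
    the closed convex hull of these limits. *)
Definition stable Y C : Prop :=
  forall c p, C c ->
    (forall H, closed_convex H -> near_identity Y [set T | H (T c)] -> H p) ->
    C p.

Definition minimal_stable_set Y C : Prop :=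
  [/\ C !=set0, closed_convex C, stable Y C &
    forall C', C' !=set0 -> closed_convex C' -> stable Y C' -> C' `<=` C ->
      C `<=` C'].

Definition isometry_invariant E : Prop :=
  forall T : {linear X -> X}, surjective_isometry T -> forall x, E x -> E (T x).

(** The removed set [H] need not be a half-space: convexity of [H] is what the
    midpoint argument uses, and convex sets are easier to exhibit. *)
Definition denting (e : K) E (c : X) : Prop :=
  exists2 H, closed_convex H /\ ~ H c &
    forall x y, E x -> E y -> ~ H x -> ~ H y -> `|x - y| <= e.

Definition dentable_envelope C : Prop :=
  forall e : K, 0 < e -> exists E,
    [/\ isometry_invariant E, C `<=` E & forall c, C c -> denting e E c].

(** An invariant closed convex set contains the orbits of its points, hence
    also their limits. *)
Lemma stableI Y C E :
  closed_convex E -> isometry_invariant E -> stable Y C -> stable Y (C `&` E).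
Proof.
move=> cE iE sC c p [Cc Ec] cp; split; first exact: sC Cc cp.
apply: cp cE _; apply: filterS (near_identity_isometry Y) => T Tiso.
exact: iE.
Qed.

(** The margin [e] makes this set closed. *)
Definition orbit_within Y (x : X) (d : K) : set X :=
  [set c | forall e : K, 0 < e ->
    near_identity Y [set T | `|T c - x| <= d + e]].

(** If [p] is a limit of [S c], then [T p] is a limit of [T (S c)] for each
    isometry [T], and both [S] and [T \o S] are close to the identity. *)
Lemma orbit_within_stable Y x d : stable Y (orbit_within Y x d).
Proof.
move=> c p Cc cp e e0; have := near_identity_comp (Cc e e0).
apply: filterS2 (near_identity_isometry Y) => T Tiso Tc /=.
apply: (cp (T @^-1` [set y | `|y - x| <= d + e])) => //.
exact/closed_convex_preimage/closed_convex_ball/Tiso.1.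
Qed.

Lemma orbit_within_closed_convex Y x d : closed_convex (orbit_within Y x d).
Proof.
split=> [|u v t t0 t1 Cu Cv e e0].
  apply/closed_normP => c cP e e0; have e20 : 0 < e / 2 by rewrite divr_gt0.
  have [a Ca ca] := cP _ e20.
  apply: filterS2 (Ca _ e20) (near_identity_isometry Y) => T Ta Tiso /=.
  have -> : T c - x = (T a - x) + T (c - a).
    by rewrite linearB [RHS]addrC addrA subrK.
  rewrite (le_trans (ler_normD _ _))// Tiso.1 [in leRHS](splitr e) addrA.
  by rewrite lerD// ltW.
apply: filterS2 (Cu _ e0) (Cv _ e0) => T Tu Tv /=.
by rewrite linearD !linearZ /= convex_combB norm_convex_comb.
Qed.

Lemma orbit_within_ball Y x d c : orbit_within Y x d c -> `|c - x| <= d.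
Proof.
by move=> Cc; apply/ler_addgt0Pr => e /Cc/near_identity_id.
Qed.

Hypothesis weak_cluster : weak_cluster_property.

(** A chain of bounded stable sets has a nonempty intersection by weak
    compactness. *)
Lemma minimal_stable Y C0 M :
  C0 !=set0 -> closed_convex C0 -> norm_bounded C0 M -> stable Y C0 ->
  exists2 C, C `<=` C0 & minimal_stable_set Y C.
Proof.
move=> C0n0 cC0 C0M sC0.
pose good C := [/\ C `<=` C0, C !=set0, closed_convex C & stable Y C].
pose S := {C | good C}.
have good0 : good C0 by split.
pose R (A B : S) := `[< sval B `<=` sval A >].
have [|||C Cmin] := @ZL_preorder S (exist _ C0 good0) R.
- by move=> A; apply/asboolP.
- by move=> A B D /asboolP BA /asboolP AD; apply/asboolP => x /AD/BA.
- move=> F Ftot; have [[A0 FA0]|F0] := pselect (exists A, F A); last first.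
    by exists (exist _ C0 good0) => A FA; exfalso; apply: F0; exists A.
  pose G : set_system X := [set B | exists2 A : S, F A & sval A `<=` B].
  have GF : ProperFilter G.
    split; first by move=> [A _ AF]; have [_ [x /AF]] := svalP A.
    split; first by exists A0.
      move=> A B [a Fa aA] [b Fb bB].
      have [/asboolP ba|/asboolP ab] := Ftot _ _ Fa Fb.
        by exists b => // x xb; split; [exact/aA/ba|exact: bB].
      by exists a => // x xa; split; [exact: aA|exact/bB/ab].
    by move=> A B AB [a Fa aA]; exists a => // x /aA/AB.
  have [|p pP] := weak_cluster GF.
    exists (sval A0); first by exists A0.
    by exists M => x xA; apply: C0M; have [+ _ _ _] := svalP A0; exact.
  have gI : good (\bigcap_(A in F) sval A).
    split.
    + by move=> x /(_ _ FA0) A0x; have [+ _ _ _] := svalP A0; exact.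
    + exists p => A FA; apply: pP; last by exists A.
      by have [] := svalP A.
    + by apply: closed_convex_bigcap => A _; have [] := svalP A.
    + by move=> c q cP cq A FA; have [_ _ _] := svalP A; apply; [exact: cP FA|].
  by exists (exist _ _ gI) => A FA; apply/asboolP => x; exact.
have [CC0 Cn0 cC sC] := svalP C; exists (sval C) => //; split=> //.
move=> C' C'n0 cC' sC' C'C.
have gC' : good C' by split=> //; exact: subset_trans CC0.
by have /asboolP := Cmin (exist _ C' gC') (asboolT C'C).
Qed.

(** A midpoint of [z] and [u] is cut off from [E] by a convex set [H] that
    cannot contain both [z] and [u], so [u] is close to [z] and [C] is reduced
    to [z]. If the orbit of [z] met the set [H] cutting off [z] arbitrarily
    close to the identity, it would have a limit in [H]; this limit would be in
    [C], hence equal to [z], which is not in [H]. *)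
Lemma dentable_stable_Env Y C M :
  closed_convex C -> norm_bounded C M -> stable Y C -> dentable_envelope C ->
  C `<=` Env Y.
Proof.
move=> [_ vC] CM sC dC z Cz.
have C1 u : C u -> u = z.
  move=> Cu; apply/eqP; rewrite -subr_eq0 -normr_le0.
  apply/ler_addgt0Pr => e e0; rewrite add0r.
  have e20 : 0 < e / 2 by rewrite divr_gt0.
  have [E [_ CE /(_ (2^-1 *: u + (1 - 2^-1) *: z))]] := dC _ e20.
  have h0 : 0 <= 2^-1 :> K by rewrite invr_ge0.
  have h1 : 2^-1 <= 1 :> K by rewrite invf_le1// ler1n.
  have Cw : C (2^-1 *: u + (1 - 2^-1) *: z) by exact: vC.
  have w2 : 1 - 2^-1 = 2^-1 :> K by rewrite {1}(splitr 1) div1r addrK.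
  move=> /(_ Cw)[H [cH nHw] HE]; have [Hu|nHu] := pselect (H u).
    have [Hz|nHz] := pselect (H z); first by case: nHw; exact: cH.2.
    have := HE _ _ (CE _ Cz) (CE _ Cw) nHz nHw.
    rewrite distrC convex_combB subrr scaler0 addr0 normrZ ger0_norm//.
    by rewrite mulrC ler_pM2r// invr_gt0.
  have := HE _ _ (CE _ Cu) (CE _ Cw) nHu nHw.
  rewrite distrC convex_combB subrr scaler0 add0r normrZ w2 ger0_norm//.
  by rewrite mulrC ler_pM2r ?invr_gt0// distrC.
apply: near_identity_Env => e /dC[E [iE CE /(_ z Cz)[H [cH nHz] HE]]].
suff : near_identity Y [set T | ~ H (T z)].
  apply: filterS2 (near_identity_isometry Y) => T Tiso nHTz /=.
  by apply: HE => //; [apply: iE => //|]; exact: CE.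
apply: contrapT => nH.
(* otherwise the orbit of z meets H arbitrarily close to the identity *)
pose G := (fun T : {linear X -> X} => T z) @
  within [set T : {linear X -> X} | H (T z)] (near_identity Y).
have GF : ProperFilter G.
  split; first by [].
  exact: fmap_filter.
have [|p pP] := weak_cluster GF.
  exists [set x | `|x| <= `|z|]; last by exists `|z|.
  by apply: filterS (near_identity_isometry Y) => T [Tiso _] _ /=; rewrite Tiso.
have Hp : H p by apply: pP => //; apply: filterS (near_identity_isometry Y).
apply: nHz; rewrite -(C1 p)//; apply: sC Cz _ => D cD DT; apply: pP => //.
by apply: filterS DT.
Qed.

End stable_sets.

(** * Dentable envelopes of minimal stable sets *)

Section envelopes.
Variables (K : numFieldType) (X : normedModType K).
Implicit Types (Y C E H : set X).

Lemma not_le_norm (x : X) (a : K) : a \is Num.real -> ~ `|x| <= a -> a < `|x|.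
Proof. by move=> ar /negP; rewrite real_ltNge// normr_real. Qed.

(** Balls around [0] are invariant, so by minimality [C] lies in the ball
    through each of its points, that is, in a sphere. On a sphere of radius [r],
    local uniform convexity at [c] says that the convex set of the [x] with
    norm of [x + c] at most [2 * (1 - d) * r] contains every point of the ball
    that is far from [c], but not [c]. *)
Lemma LUC_envelope Y C : locally_uniformly_convex X ->
  minimal_stable_set Y C -> dentable_envelope C.
Proof.
move=> luc [[c0 Cc0] cC sC Cmin] e e0.
have Cball c : C c -> C `<=` [set x | `|x - 0| <= `|c|].
  move=> Cc x Cx.
  have cB := closed_convex_ball (0 : X) `|c|.
  have iB : isometry_invariant [set x : X | `|x - 0| <= `|c|].
    by move=> T [Tiso _] y /=; rewrite !subr0 Tiso.
  suff /(_ x Cx)[] : C `<=` C `&` [set x | `|x - 0| <= `|c|] by [].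
  apply: Cmin => [|||y []//]; [|exact: closed_convexI|exact: stableI].
  by exists c; split=> //=; rewrite subr0.
pose r := `|c0|; exists [set x | `|x - 0| <= r]; split.
- by move=> T [Tiso _] y /=; rewrite !subr0 Tiso.
- exact: Cball.
move=> c Cc; have cr : `|c| = r.
  apply/eqP; rewrite eq_le; have := Cball _ Cc0 _ Cc; have := Cball _ Cc _ Cc0.
  by rewrite /= !subr0 => -> ->.
have := normr_ge0 c0; rewrite -/r le_eqVlt => /orP[/eqP r0|r0].
  (* the ball is reduced to the point 0 *)
  exists set0; first by split=> //; exact: closed_convex0.
  move=> x y /=; rewrite -r0 !subr0 !normr_le0 => /eqP-> /eqP-> _ _.
  by rewrite subrr normr0 ltW.
have rn0 : r != 0 by rewrite gt_eqF.
have c1 : `|r^-1 *: c| = 1 by rewrite normrZ cr gtr0_norm ?invr_gt0// mulVf.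
have e'0 : 0 < e / 2 / r by rewrite !divr_gt0.
have [d d0 dP] := luc _ _ c1 e'0.
have near x : `|x - 0| <= r -> ~ `|x - - c| <= 2 * (1 - d) * r ->
    `|x - c| < e / 2.
  rewrite subr0 opprK => xr xc.
  have ri0 : 0 < r^-1 by rewrite invr_gt0.
  have dr : 2 * (1 - d) * r \is Num.real.
    by rewrite !realM ?realB ?realn ?gtr0_real.
  have := dP (r^-1 *: x); rewrite -scalerDr -scalerBr !normrZ.
  rewrite (gtr0_norm ri0) (gtr0_norm (_ : 0 < 2^-1)) ?invr_gt0//.
  rewrite ![r^-1 * _]mulrC ler_pdivrMr// ltr_pM2r// mul1r => /(_ xr); apply.
  rewrite [ltRHS]mulrC ltr_pdivlMr// ltr_pdivlMr// [(1 - d) * 2]mulrC.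
  exact: not_le_norm dr xc.
exists [set x | `|x - - c| <= 2 * (1 - d) * r].
  split; first exact: closed_convex_ball.
  rewrite /= opprK -mulr2n -scaler_nat normrZ normr_nat cr -mulrA ler_pM2l//.
  by rewrite ler_pMl// lerBrDr gerDl lt_geF.
move=> x y Ex Ey Hx Hy; rewrite -(subrKA c) (le_trans (ler_normD _ _))//.
by rewrite [leRHS]splitr lerD// ltW ?near// distrC near.
Qed.

(** Take for [E] the least closed convex invariant set containing [C], and for
    [D] the set of its points without small slices. [D] is convex because a
    convex set missing a convex combination misses one of the two points. If
    [C] met [D], then [C] would be contained in [D] by minimality, hence [E]
    too; but a dentable set has points outside [D]. *)
Lemma dentable_stable_envelope Y C M :
  (forall E (e : K), E !=set0 -> closed_convex E -> norm_bounded E M -> 0 < e ->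
     exists2 x, E x & denting e E x) ->
  norm_bounded C M -> minimal_stable_set Y C -> dentable_envelope C.
Proof.
move=> dent CM [[c0 Cc0] cC sC Cmin] e e0.
pose inv := [set B | [/\ closed_convex B, isometry_invariant B & C `<=` B]].
pose E := \bigcap_(B in inv) B.
have invE : inv E.
  split; first by apply: closed_convex_bigcap => B [].
    by move=> T Tiso x Ex B iB; have [_ + _] := iB; apply => //; exact: Ex.
  by move=> x Cx B [_ _]; exact.
have [cE iE CE] := invE; exists E; split=> // c Cc; apply: contrapT => ndc.
pose D := [set x | E x /\ ~ denting e E x].
have cD : closed_convex D.
  split=> [|u v t t0 t1 [Eu nu] [Ev nv]].
    apply/closed_normP => x xD; split.
      move/closed_normP: cE.1; apply => d /xD[a [Ea _] xa].
      by exists a.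
    move=> [H [cH nHx] HE]; apply: nHx.
    move/closed_normP: cH.1; apply => d /xD[a [Ea na] xa]; exists a => //.
    by apply: contrapT => nHa; apply: na; exists H.
  split; first exact: cE.2.
  move=> [H [cH nH] HE].
  have [Hu|nHu] := pselect (H u); last by apply: nu; exists H.
  have [Hv|nHv] := pselect (H v); last by apply: nv; exists H.
  by apply: nH; exact: cH.2.
have iD : isometry_invariant D.
  move=> T Tiso x [Ex nx]; split; first exact: iE.
  move=> [H [cH nH] HE]; apply: nx; exists (T @^-1` H).
    by split=> //; apply: closed_convex_preimage cH; exact: Tiso.1.
  move=> y z Ey Ez Hy Hz; rewrite -Tiso.1 linearB.
  by apply: HE => //; exact: iE.
have CD : C `<=` D.
  suff : C `<=` C `&` D by move=> CCD x /CCD[].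
  apply: Cmin; [|exact: closed_convexI|exact: stableI|by move=> x []].
  by exists c; split=> //; split=> //; exact: CE.
have ED : E `<=` D by apply: bigcap_inf; split.
have EM : norm_bounded E M.
  have : inv [set x | `|x - 0| <= M].
    split; first exact: closed_convex_ball.
      by move=> T [Tiso _] x /=; rewrite !subr0 Tiso.
    by move=> x Cx /=; rewrite subr0 CM.
  by move=> + x Ex => /Ex /=; rewrite subr0.
have [|x Ex dx] := dent E e _ cE EM e0; first by exists c; exact: CE.
by have [_] := ED x Ex.
Qed.

End envelopes.

(** * Dentability of bounded closed convex sets in separable spaces *)

Section dentability.
Variables (K : numFieldType) (X : normedModType K).
Implicit Types (A B C E H P Q : set X).

(** The sets [P] and [Q] stand for two complementary closed half-spaces. *)
Definition separation_property : Prop :=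
  forall H x, closed_convex H -> ~ H x ->
    exists P Q, [/\ closed_convex P, closed_convex Q, forall y, P y \/ Q y,
      ~ P x & forall y, H y -> ~ Q y].

Lemma convex_combE C u v (a b : K) : closed_convex C ->
  C u -> C v -> 0 <= a -> 0 <= b ->
  exists2 w, C w & a *: u + b *: v = (a + b) *: w.
Proof.
move=> [_ vC] Cu Cv a0 b0; have [ab0|ab0] := eqVneq (a + b) 0.
  move/eqP: (ab0); rewrite paddr_eq0// => /andP[/eqP-> /eqP->].
  by exists u => //; rewrite add0r !scale0r addr0.
have abp : 0 < a + b by rewrite lt_neqAle eq_sym ab0 addr_ge0.
have b1 : 1 - a / (a + b) = b / (a + b).
  by rewrite -[X in X - _](divff ab0) -mulrBl addrAC subrr add0r.
exists (a / (a + b) *: u + (1 - a / (a + b)) *: v).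
  by apply: vC => //; rewrite ?divr_ge0 ?ler_pdivrMr ?mul1r ?lerDl// ltW.
by rewrite b1 scalerDr !scalerA ![(a + b) * _]mulrC !divfK.
Qed.

(** For [r = 0] and nonempty convex [C1] and [C2] this is the convex hull of
    their union; for [r > 0] the weight of [C1] is bounded from below. *)
Definition join (r : K) C1 C2 : set X :=
  [set x | exists t u v,
     [/\ r <= t, t <= 1, C1 u, C2 v & x = t *: u + (1 - t) *: v]].

Lemma closed_convex_join (r : K) C1 C2 : 0 <= r ->
  closed_convex C1 -> closed_convex C2 ->
  closed_convex (closure (join r C1 C2)).
Proof.
move=> r0 cC1 cC2; apply: closed_convex_closure.
move=> _ _ l l0 l1 [t [u [v [rt t1 Cu Cv ->]]]] [s [w [z [rs s1 Cw Cz ->]]]].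
have t0 := le_trans r0 rt; have s0 := le_trans r0 rs.
have l'0 : 0 <= 1 - l by rewrite subr_ge0.
have [a Ca aE] := convex_combE cC1 Cu Cw (mulr_ge0 l0 t0) (mulr_ge0 l'0 s0).
have [b Cb bE] : exists2 b, C2 b & l * (1 - t) *: v + (1 - l) * (1 - s) *: z =
    (l * (1 - t) + (1 - l) * (1 - s)) *: b.
  by apply: convex_combE => //; rewrite mulr_ge0// subr_ge0.
have lr : l * r + (1 - l) * r = r by ring.
have lo : l * 1 + (1 - l) * 1 = 1 :> K by ring.
exists (l * t + (1 - l) * s), a, b; split=> //.
- by rewrite -[leLHS]lr lerD// ler_wpM2l.
- by rewrite -[leRHS]lo lerD// ler_wpM2l.
rewrite !scalerDr !scalerA addrACA aE bE; congr (_ *: _ + _ *: _); ring.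
Qed.

Hypothesis archimedean : forall a : K, 0 <= a -> exists n : nat, a < n%:R.

Lemma geometric_small (s a e : K) : 0 < s -> s <= 1 -> 0 < a -> 0 < e ->
  exists n, a * (1 - s) ^+ n < e.
Proof.
move=> s0 s1 a0 e0; have s'0 : 0 <= 1 - s by rewrite subr_ge0.
(* the inequality of Bernoulli for the inverse of 1 - s, without division *)
have bern n : (1 - s) ^+ n * (1 + n%:R * s) <= 1.
  elim: n => [|n IHn]; first by rewrite expr0 mul0r addr0 mulr1.
  apply: le_trans IHn; rewrite exprS [(1 - s) * _]mulrC -mulrA.
  rewrite ler_wpM2l ?exprn_ge0// -subr_ge0.
  have -> : 1 + n%:R * s - (1 - s) * (1 + n.+1%:R * s) = n.+1%:R * (s * s).
    by rewrite -natr1; ring.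
  by rewrite mulr_ge0// mulr_ge0// ltW.
have [n an] := archimedean (divr_ge0 (ltW a0) (ltW (mulr_gt0 e0 s0))).
exists n; move: an; rewrite ltr_pdivrMr ?mulr_gt0// => an.
have ns0 : 0 < 1 + n%:R * s by rewrite ltr_wpDr// mulr_ge0// ltW.
rewrite -(ltr_pM2r ns0) -mulrA.
apply: le_lt_trans (_ : a * 1 < _); first by rewrite ler_wpM2l ?bern// ltW.
rewrite mulr1 (lt_le_trans an)//.
have -> : n%:R * (e * s) = e * (n%:R * s) by ring.
by rewrite mulrDr mulr1 lerDr ltW.
Qed.

(** The points of the join are closer to [C1] than the points of [E] by a
    factor [1 - r], so if the join is dense in [E] then iterating shows that the
    points of [E] are at distance [0] from [C1]. *)
Lemma join_proper (r M : K) C1 C2 E : 0 < r -> r <= 1 -> 0 < M ->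
  norm_bounded E M -> closed_convex C1 -> C1 `<=` E -> C2 `<=` E ->
  C1 !=set0 -> E `<=` closure (join r C1 C2) -> E `<=` C1.
Proof.
move=> r0 r1 M0 EM [cC1 vC1] CE1 CE2 [c Cc] EJ.
have r20 : 0 < r / 2 by rewrite divr_gt0.
have step m : 0 < m ->
    (forall x, E x -> exists2 z, C1 z & `|x - z| <= m) ->
    forall x, E x -> exists2 z, C1 z & `|x - z| <= m * (1 - r / 2).
  move=> m0 IH x /EJ/closure_normP/(_ _ (mulr_gt0 m0 r20)).
  move=> [_ [t [u [v [rt t1 Cu Cv ->]]]] xt].
  have [z Cz vz] := IH v (CE2 _ Cv).
  have t0 := le_trans (ltW r0) rt.
  exists (t *: u + (1 - t) *: z); first exact: vC1.
  rewrite -(subrKA (t *: u + (1 - t) *: v)) (le_trans (ler_normD _ _))//.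
  have -> : m * (1 - r / 2) = m * (r / 2) + (1 - r) * m by field.
  rewrite lerD//; first exact: ltW xt.
  rewrite opprD addrACA subrr add0r -scalerBr normrZ.
  have t'0 : 0 <= 1 - t by rewrite subr_ge0.
  by rewrite (ger0_norm t'0) ler_pM// lerB.
have r21 : r / 2 < 1 by rewrite ltr_pdivrMr// mul1r (le_lt_trans r1)// ltr1n.
have approx n x : E x -> exists2 z, C1 z & `|x - z| <= M * 2 * (1 - r / 2) ^+ n.
  elim: n x => [x Ex|n IHn].
    exists c => //; rewrite expr0 mulr1 mulr_natr mulr2n.
    by rewrite (le_trans (ler_normB _ _))// lerD// EM//; exact: CE1.
  rewrite exprSr mulrA; apply: step => //.
  by rewrite mulr_gt0 ?exprn_gt0 ?mulr_gt0// subr_gt0.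
move=> x Ex; move/closed_normP: cC1; apply => e e0.
have [n ne] := geometric_small r20 (ltW r21) (mulr_gt0 M0 (ltr0n K 2)) e0.
by have [z Cz xz] := approx n x Ex; exists z => //; exact: le_lt_trans ne.
Qed.

(** The lemma of Namioka and Asplund. For small [r] the closed join of weight
    [r] does not contain [E] by [join_proper]. A point of [E] outside it is a
    limit of combinations where [C1] has weight less than [r], so it is close to
    the small set [C2]. *)
Lemma join_denting (M e : K) C1 C2 E b : 0 < M -> 0 < e ->
  norm_bounded E M -> closed_convex C1 -> C1 `<=` E ->
  closed_convex C2 -> C2 `<=` E -> (forall x, C2 x -> `|x - b| <= e / 8) ->
  C1 !=set0 -> ~ E `<=` C1 -> E `<=` closure (join 0 C1 C2) ->
  exists2 x, E x & denting e E x.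
Proof.
move=> M0 e0 EM cC1 CE1 cC2 CE2 C2b C10 EC1 EJ.
have e80 : 0 < e / 8 by rewrite divr_gt0.
have M20 : 0 < M * 2 by rewrite mulr_gt0.
(* r times the diameter of E, which is at most M * 2, must not exceed e / 8 *)
have [r [r0 r1 rM]] := pos_lower_bound (ltr01 : 0 < 1 :> K) (divr_gt0 e80 M20).
have /existsNP[x /not_implyP[Ex nx]] : ~ E `<=` closure (join r C1 C2).
  by move=> EJr; have := join_proper r0 r1 M0 EM cC1 CE1 CE2 C10 EJr.
exists x => //; exists (closure (join r C1 C2)).
  by split=> //; apply: closed_convex_join => //; exact: ltW.
have near y : E y -> ~ closure (join r C1 C2) y -> `|y - b| <= e / 2.
  move=> Ey ny; have /existsNP[d /not_implyP[d0 dP]] :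
      ~ forall d : K, 0 < d -> exists2 a, join r C1 C2 a & `|y - a| < d.
    by move=> yP; apply: ny; exact/closure_normP.
  have [k [k0 kd ke]] := pos_lower_bound d0 e80.
  have /closure_normP/(_ _ k0)[a [t [u [v [t0 t1 Cu Cv aE]]]] ya] := EJ y Ey.
  have tr : t <= r.
    have [rt|rt] := real_leP (ger0_real t0) (gtr0_real r0); first by [].
    case: dP; exists a; last exact: lt_le_trans kd.
    by exists t, u, v; split=> //; exact: ltW.
  have -> : y - b = (y - a) + ((v - b) + t *: (u - v)).
    have aE' : a = v + t *: (u - v).
      by rewrite aE scalerBl scale1r scalerBr addrCA.
    by rewrite [v - b + _]addrAC -aE' subrKA.
  have -> : e / 2 = e / 8 + (e / 8 + (e / 8 + e / 8)) by field.
  rewrite (le_trans (ler_normD _ _))// lerD//.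
    exact: le_trans (ltW ya) ke.
  rewrite (le_trans (ler_normD _ _))// lerD ?C2b//.
  rewrite normrZ (ger0_norm t0) ler_wpDr ?(ltW e80)//.
  move: rM; rewrite ler_pdivlMr//; apply: le_trans; rewrite ler_pM//.
  rewrite (le_trans (ler_normB _ _))// mulr_natr mulr2n.
  by rewrite lerD// EM//; [exact: CE1|exact: CE2].
move=> y z Ey Ez ny nz; rewrite -(subrKA b) (le_trans (ler_normD _ _))//.
by rewrite [leRHS]splitr lerD ?near// distrC near.
Qed.

Hypothesis weak_cluster : weak_cluster_property X.
Hypothesis separation : separation_property.

(** If [E] has no small slice, then inside the slice of [E] left by [P] there is
    another one that avoids the small ball around [b]: by [join_denting], the
    closed convex hull of the parts of [E] in [P] and in the ball is not all of
    [E], and a point outside it can be separated from it. *)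
Lemma shrink_slice (M e : K) E P b : 0 < M -> 0 < e ->
  norm_bounded E M -> closed_convex E -> (forall x, E x -> ~ denting e E x) ->
  closed_convex P -> ~ E `<=` P ->
  exists P' Q', [/\ closed_convex P', closed_convex Q', forall y, P' y \/ Q' y,
    ~ E `<=` P' &
    forall y, E y -> Q' y -> ~ P y /\ ~ (`|y - b| <= e / 8)].
Proof.
move=> M0 e0 EM cE nd cP EP.
have /existsNP[x0 /not_implyP[Ex0 _]] := EP.
pose B := [set x | `|x - b| <= e / 8].
have cB : closed_convex B by exact: closed_convex_ball.
have [H [cH PH BH EH]] : exists H, [/\ closed_convex H, E `&` P `<=` H,
    E `&` B `<=` H & ~ E `<=` H].
  have [EP0|/set0P EP0] := eqVneq (E `&` P) set0.
    exists B; split; [by []|by rewrite EP0|by move=> x []|].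
    move=> EB; apply: nd Ex0 _; exists set0.
      by split=> //; exact: closed_convex0.
    move=> y z /EB/= yb /EB/= zb _ _; rewrite -(subrKA b).
    rewrite (le_trans (ler_normD _ _))// (distrC b) (le_trans (lerD yb zb))//.
    rewrite -mulrDr -[leRHS]mulr1 ler_pM2l// -mulr2n -[_ *+ 2]mulr_natr.
    by rewrite mulrC ler_pdivrMr// mul1r ler_nat.
  have [EB0|/set0P EB0] := eqVneq (E `&` B) set0.
    by exists P; split; [|move=> x []|rewrite EB0|].
  exists (closure (join 0 (E `&` P) (E `&` B))); split.
  - by apply: closed_convex_join => //; exact: closed_convexI.
  - move=> x xP; apply: subset_closure; have [y yB] := EB0.
    by exists 1, x, y; split=> //; rewrite subrr scale0r addr0 scale1r.
  - move=> x xB; apply: subset_closure; have [y yP] := EP0.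
    by exists 0, y, x; split=> //; rewrite subr0 scale0r add0r scale1r.
  - move=> EJ; have EEP : ~ E `<=` E `&` P by move=> EEP; apply: EP => x /EEP[].
    have EB x : (E `&` B) x -> `|x - b| <= e / 8 by case.
    have [x Ex] := join_denting M0 e0 EM (closed_convexI cE cP)
      (@subIsetl _ _ _)
      (closed_convexI cE cB) (@subIsetl _ _ _) EB EP0 EEP EJ.
    exact: nd.
have /existsNP[x /not_implyP[Ex nHx]] := EH.
have [P' [Q' [cP' cQ' PQ' nP'x HQ']]] := separation cH nHx.
exists P', Q'; split=> //; first by move=> /(_ _ Ex).
move=> y Ey Q'y; split=> [Py|yb]; apply: HQ' Q'y.
  exact: PH.
exact: BH.
Qed.

(** Otherwise [shrink_slice] yields a decreasing sequence of closed slices that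
    avoid one after the other the balls around the points of a dense sequence.
    By weak compactness they have a common point, which is in none of the balls;
    but these cover the space. *)
Lemma separable_dentable (M e : K) E : separable_space X ->
  E !=set0 -> closed_convex E -> norm_bounded E M -> 0 < e ->
  exists2 x, E x & denting e E x.
Proof.
move=> [D cD dD] [x0 Ex0] cE EM e0; apply: contrapT => nd0.
have nd x : E x -> ~ denting e E x by move=> Ex dx; apply: nd0; exists x.
have M0 : 0 < M + 1 by rewrite ltr_wpDl// (le_trans _ (EM _ Ex0)).
have {}EM : norm_bounded E (M + 1).
  by move=> x /EM xM; rewrite (le_trans xM)// lerDl.
have e80 : 0 < e / 8 by rewrite divr_gt0.
have [d dP] : exists d : nat -> X, forall x, exists n, `|x - d n| < e / 8.
  have [i iinj] := countable_injP _ cD.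
  (* numbers that are not codes of points of D get the value 0 *)
  pose d n := xget 0 [set x | D x /\ i x = n]; exists d => x.
  have [y [/interior_subset xy Dy]] : interior (ball x (e / 8)) `&` D !=set0.
    apply: dD; last exact: open_interior.
    by exists x; exact: nbhsx_ballx.
  exists (i y); have /= [Dd id] : [set z | D z /\ i z = i y] (d (i y)).
    by apply: xgetPex; exists y.
  have -> : d (i y) = y by apply: iinj => //; exact: mem_set.
  by move: xy; rewrite -ball_normE.
(* a state is a pair of half-spaces, the second one carrying the slice *)
pose good (s : set X * set X) := [/\ closed_convex s.1, closed_convex s.2,
  forall y, s.1 y \/ s.2 y & ~ E `<=` s.1].
pose S := {s | good s}.
have /choice[f fP] : forall sb : S * X, exists s' : S, forall y, E y ->
    (sval s').2 y -> ~ (sval sb.1).1 y /\ ~ (`|y - sb.2| <= e / 8).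
  move=> [s b]; have [cP _ _ EP] := svalP s.
  have [P' [Q' [cP' cQ' PQ' EP' HP']]] := shrink_slice b M0 e0 EM cE nd cP EP.
  by exists (exist good (P', Q') (And4 cP' cQ' PQ' EP')).
have g0 : good (set0, setT).
  split; [exact: closed_convex0|exact: closed_convexT|by right|].
  by move=> /(_ _ Ex0).
pose s := fix s n := if n is n'.+1 then f (s n', d n') else exist good _ g0.
have sS n y : E y -> (sval (s n.+1)).2 y ->
    (sval (s n)).2 y /\ ~ (`|y - d n| <= e / 8).
  move=> Ey sy; have [nP nb] := fP (s n, d n) y Ey sy; split=> //.
  by have [_ _ /(_ y)[]] := svalP (s n).
pose G n := E `&` (sval (s n)).2.
have Gle m n : (m <= n)%N -> G n `<=` G m.
  elim: n => [|n IHn]; first by rewrite leqn0 => /eqP->.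
  rewrite leq_eqVlt => /orP[/eqP->//|mn] y [Ey sy]; apply: IHn => //.
  by split=> //; have [] := sS n y Ey sy.
have GF : ProperFilter (filter_from setT G).
  apply: filter_from_proper; last first.
    move=> n _; have [_ _ PQ /existsNP[y /not_implyP[Ey nPy]]] := svalP (s n).
    by exists y; split=> //; have [] := PQ y.
  apply: filter_from_filter; first by exists 0%N.
  move=> m n _ _; exists (maxn m n) => // y Gy; split.
    exact: Gle (leq_maxl _ _) _ Gy.
  exact: Gle (leq_maxr _ _) _ Gy.
have [|p pP] := weak_cluster GF.
  by exists E; [exists 0%N => // y []|exists (M + 1)].
have Ep : E p by apply: pP => //; exists 0%N => // y [].
have [n nP] := dP p.
have [|_] := sS n p Ep; last by apply; exact: ltW.
by apply: pP; [have [] := svalP (s n.+1)|exists n.+1 => // y []].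
Qed.

End dentability.

(** * Real parts of scalars and of functionals *)

Section real_forms.
Variables (R : realType) (K : numFieldType).

Definition real_linear (iota : R -> K) (V : lmodType K) (g : V -> R) : Prop :=
  (forall x y, g (x + y) = g x + g y) /\ forall r x, g (iota r *: x) = r * g x.

(** The scalars [K] are related to the real numbers by an embedding [iota] and
    a real part [rho], so that one proof covers both cases. The last field
    recovers a [K]-linear functional from its real part; over the complex
    numbers it is [g x - 'i * g ('i *: x)], whence the two terms in the
    bound. *)
Record real_form (iota : R -> K) (rho : K -> R) : Prop := RealForm {
  iota_mono : forall a b, (iota a <= iota b) = (a <= b);
  iotaD : forall a b, iota (a + b) = iota a + iota b;
  iotaM : forall a b, iota (a * b) = iota a * iota b;
  iota1 : iota 1 = 1;
  iotaK : forall z, 0 <= z -> iota (rho z) = z;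
  rhoD : forall y z, rho (y + z) = rho y + rho z;
  rhoZ : forall r z, rho (iota r * z) = r * rho z;
  rho_norm : forall z, iota `|rho z| <= `|z|;
  real_linear_lift : forall (V : lmodType K) (g : V -> R), real_linear iota g ->
    exists (f : {linear V -> K^o}) (j : K),
      [/\ forall x, rho (f x) = g x, `|j| = 1 &
          forall x, `|f x| <= iota `|g x| + iota `|g (j *: x)| ] }.

End real_forms.

Lemma linear_pack (K : pzRingType) (V W : lmodType K) (f : V -> W) : linear f ->
  exists F : {linear V -> W}, F = f :> (V -> W).
Proof.
move=> lf; pose m := GRing.isLinear.Build K V W *:%R f lf.
by exists (HB.pack f m : {linear V -> W}).
Qed.

Lemma real_form_real (R : realType) :
  real_form (fun x : R => x) (fun x : R => x).
Proof.
split=> // V g [gD gZ].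
have [|f fE] := @linear_pack R V R^o g; first by move=> a x y; rewrite gD gZ.
exists f, 1; rewrite fE; split=> //; first by rewrite normr1.
by move=> x; rewrite scale1r lerDl.
Qed.

Lemma real_form_complex (R : realType) :
  real_form (real_complex R) (@complex.Re R).
Proof.
split.
- by move=> a b; rewrite lecR.
- by move=> a b; rewrite rmorphD.
- by move=> a b; rewrite rmorphM.
- by [].
- by move=> [a b]; rewrite lecE /= => /andP[/eqP-> _].
- by move=> [a b] [c d].
- by move=> r [a b] /=; rewrite mul0r subr0.
- exact: normc_ge_Re.
move=> V g [gD gZ].
have g0 : g 0 = 0 by rewrite -(scale0r 0) -(rmorph0 (real_complex R)) gZ mul0r.
have gN x : g (- x) = - g x.
  by apply: (addIr (g x)); rewrite -gD !addNr.
pose f (x : V) : R[i]^o := Complex (g x) (- g (Complex 0 1 *: x)).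
have gC (a b : R) x : g (Complex a b *: x) = a * g x + b * g (Complex 0 1 *: x).
  rewrite -!gZ -gD scalerA -scalerDl; congr (g (_ *: _)).
  by apply/eqP; rewrite eq_complex /=; simpc.
have lf : linear f.
  move=> [a b] x y; apply/eqP; rewrite eq_complex /= !gD scalerDr gD gC.
  have -> : Complex 0 1 *: (Complex a b *: x) = Complex (- b) a *: x.
    by rewrite scalerA; congr (_ *: _); apply/eqP; rewrite eq_complex /=; simpc.
  by rewrite (gC (- b) a); apply/andP; split; apply/eqP; ring.
have [F FE] := linear_pack lf; exists F, (Complex 0 1); rewrite FE; split=> //.
  by rewrite normc_def /= expr0n expr1n add0r sqrtr1.
move=> x; have -> : f x = (real_complex R (g x)) -
    Complex 0 1 * real_complex R (g (Complex 0 1 *: x)).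
  by apply/eqP; rewrite eq_complex /=; simpc.
rewrite (le_trans (ler_normB _ _))// normrM !normc_def /= !expr0n /=.
by rewrite expr1n add0r sqrtr1 mul1r !addr0 !sqrtr_sqr.
Qed.

Lemma real_or_complex_form (R : realType) (K : numFieldType) :
  real_or_complex R K -> exists iota rho, @real_form R K iota rho.
Proof.
case; first by exists (fun x => x), (fun x => x); exact: real_form_real.
by exists (real_complex R), (@complex.Re R); exact: real_form_complex.
Qed.

(** * The theorem of Hahn and Banach *)

Section hahn_banach.
Variables (R : realType) (K : numFieldType) (iota : R -> K) (rho : K -> R).
Hypothesis rf : real_form iota rho.

Lemma iota0 : iota 0 = 0.
Proof. by apply: (addrI (iota 0)); rewrite -(iotaD rf) !addr0. Qed.

Section sublinear.
Variable V : lmodType K.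
Implicit Types (p q : V -> R) (H : set V).

Definition sublinear q : Prop :=
  (forall x y, q (x + y) <= q x + q y) /\
  (forall r x, 0 <= r -> q (iota r *: x) = r * q x).

Lemma iota_scaleK (r : R) (x : V) : r != 0 -> iota r^-1 *: (iota r *: x) = x.
Proof.
by move=> r0; rewrite scalerA -(iotaM rf) mulVf// (iota1 rf) scale1r.
Qed.

Lemma sublinearP q : (forall x y, q (x + y) <= q x + q y) -> q 0 = 0 ->
  (forall r x, 0 < r -> q (iota r *: x) <= r * q x) -> sublinear q.
Proof.
move=> qD q0 qZ; split=> // r x; rewrite le_eqVlt => /orP[/eqP<-|r0].
  by rewrite iota0 scale0r q0 mul0r.
apply/eqP; rewrite eq_le qZ//=; have rn0 : r != 0 by rewrite gt_eqF.
have := @qZ r^-1 (iota r *: x); rewrite invr_gt0 iota_scaleK// => /(_ r0).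
by rewrite -(ler_pM2l r0) mulrA divff// mul1r.
Qed.

Lemma sublinear0 q : sublinear q -> q 0 = 0.
Proof. by move=> [_ /(_ 0 0 (lexx 0))]; rewrite scaler0 mul0r. Qed.

Lemma sublinearN q x : sublinear q -> - q (- x) <= q x.
Proof.
move=> sq; have := sq.1 x (- x); rewrite subrr sublinear0// => h.
by rewrite -subr_ge0 opprK.
Qed.

(** Convexity, in the form suited to homogeneous functions: the set of the
    nonnegative multiples of the points of [H] is closed under addition. *)
Definition conic H : Prop := forall h k a b, H h -> H k -> 0 <= a -> 0 <= b ->
  exists2 w, H w & iota a *: h + iota b *: k = iota (a + b) *: w.

Lemma inf_le (A : set R) (m x : R) : lbound A m -> A x -> inf A <= x.
Proof. by move=> Am Ax; apply: ge_inf => //; exists m. Qed.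

(** The function [q' x], the infimum of [q (x + t h) - t d] over [t >= 0] and
    [h] in [H], is the largest sublinear minorant of [q] that is at most [- d]
    at all [- h]; the bound [d <= q h] keeps the infimum finite. It is applied
    with [H] a point, to see that minimal sublinear functions are odd, and with
    [H] a translate of a convex set, to separate. *)
Lemma sublinear_push q H d : sublinear q -> conic H -> H !=set0 ->
  (forall h, H h -> d <= q h) ->
  exists q', [/\ sublinear q', forall x, q' x <= q x &
    forall h, H h -> q' (- h) <= - d].
Proof.
move=> sq cH [h0 Hh0] dq.
pose A x := [set r | exists t h,
  [/\ 0 <= t, H h & r = q (x + iota t *: h) - t * d]].
have A0 x : A x !=set0 by exists (q (x + iota 0 *: h0) - 0 * d), 0, h0.
have Alb x : lbound (A x) (- q (- x)).
  move=> _ [t [h [t0 Hh ->]]].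
  have := sq.1 (x + iota t *: h) (- x); rewrite addrAC subrr add0r sq.2// => qt.
  have := ler_wpM2l t0 (dq h Hh); lra.
have Aq x : A x (q x).
  by exists 0, h0; rewrite iota0 scale0r addr0 mul0r subr0.
exists (fun x => inf (A x)); split.
- apply: sublinearP => [x y||r x r0].
  + rewrite -lerBlDr; apply: lb_le_inf => // _ [t [h [t0 Hh ->]]].
    rewrite lerBlDr -lerBlDl; apply: lb_le_inf => // _ [s [k [s0 Hk ->]]].
    have [w Hw wE] := cH h k t s Hh Hk t0 s0.
    have -> : q (y + iota s *: k) - s * d =
      (q (x + iota t *: h) - t * d) + (q (y + iota s *: k) - s * d) -
      (q (x + iota t *: h) - t * d) by ring.
    rewrite lerB//.
    have := sq.1 (x + iota t *: h) (y + iota s *: k).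
    rewrite addrACA wE => qD.
    apply: (@le_trans _ _ (q (x + y + iota (t + s) *: w) - (t + s) * d));
      last lra.
    apply: inf_le (Alb _) _; exists (t + s), w; split=> //; exact: addr_ge0.
  + apply/eqP; rewrite eq_le; apply/andP; split.
      by rewrite -[leRHS](sublinear0 sq); exact: inf_le (Alb _) (Aq _).
    apply: lb_le_inf => // r /Alb.
    by rewrite oppr0 (sublinear0 sq) oppr0.
  + rewrite -ler_pdivrMl//; apply: lb_le_inf => // _ [t [h [t0 Hh ->]]].
    rewrite ler_pdivrMl//; apply: inf_le (Alb _) _; exists (r * t), h.
    split=> //; first by rewrite mulr_ge0// ltW.
    rewrite (iotaM rf) -scalerA -scalerDr sq.2 ?ltW//; ring.
- by move=> x; exact: inf_le (Alb x) (Aq x).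
- move=> h Hh; apply: inf_le (Alb _) _; exists 1, h; split=> //.
  by rewrite (iota1 rf) scale1r addNr (sublinear0 sq) mul1r add0r.
Qed.

Lemma minimal_sublinear p : sublinear p ->
  exists q, [/\ sublinear q, forall x, q x <= p x &
    forall q', sublinear q' -> (forall x, q' x <= q x) ->
      forall x, q x <= q' x].
Proof.
move=> sp; pose good q := sublinear q /\ forall x, q x <= p x.
have good0 : good p by split.
pose S := {q | good q}.
pose le (a b : S) := `[< forall x, sval b x <= sval a x >].
have [||F Ftot|[q [sq qp]] qmin] := @ZL_preorder S (exist _ p good0) le.
- by move=> a; apply/asboolP.
- move=> a b c /asboolP ba /asboolP ac; apply/asboolP => x.
  exact: le_trans (ac x) (ba x).
- have [[a0 Fa0]|F0] := pselect (exists a, F a); last first.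
    by exists (exist _ p good0) => a Fa; exfalso; apply: F0; exists a.
  pose A x := [set r | exists2 a, F a & r = sval a x].
  have A0 x : A x !=set0 by exists (sval a0 x), a0.
  have Alb x : lbound (A x) (- p (- x)).
    move=> _ [[a [sa ap]] _ ->] /=; apply: le_trans (sublinearN x sa).
    by rewrite lerN2.
  have AF x a : F a -> inf (A x) <= sval a x.
    by move=> Fa; apply: inf_le (Alb x) _; exists a.
  have gi : good (fun x => inf (A x)).
    split; last first.
      by move=> x; apply: le_trans (AF x a0 Fa0) _; have [_] := svalP a0; exact.
    apply: sublinearP => [x y||r x r0].
    + rewrite -lerBlDr; apply: lb_le_inf => // _ [a Fa ->].
      rewrite lerBlDr -lerBlDl; apply: lb_le_inf => // _ [b Fb ->].
      rewrite lerBlDl; have [/asboolP ba|/asboolP ab] := Ftot _ _ Fa Fb.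
        apply: le_trans (AF _ b Fb) _; have [sb _] := svalP b.
        by apply: le_trans (sb.1 x y) _; rewrite lerD2r.
      apply: le_trans (AF _ a Fa) _; have [sa _] := svalP a.
      by apply: le_trans (sa.1 x y) _; rewrite lerD2l.
    + have E : A 0 = [set 0].
        apply/seteqP; split=> [_ [a Fa ->]|_ ->].
          by have [sa _] := svalP a; exact: sublinear0.
        by exists a0 => //; have [sa _] := svalP a0; rewrite sublinear0.
      by rewrite E inf1.
    + rewrite -ler_pdivrMl//; apply: lb_le_inf => // _ [a Fa ->].
      rewrite ler_pdivrMl//; have [sa _] := svalP a.
      by rewrite -(sa.2 _ _ (ltW r0)); exact: AF.
  by exists (exist _ _ gi) => a Fa; apply/asboolP => x; exact: AF.
exists q; split=> // q' sq' q'q x.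
have gq' : good q' by split=> // y; exact: le_trans (q'q y) (qp y).
by have /asboolP/(_ x) := qmin (exist _ q' gq') (asboolT q'q).
Qed.

(** Applying [sublinear_push] to a point [y] and [d = q y] gives
    [q (- y) <= - q y]. An odd sublinear function is linear. *)
Lemma minimal_sublinear_linear q : sublinear q ->
  (forall q', sublinear q' -> (forall x, q' x <= q x) ->
    forall x, q x <= q' x) ->
  real_linear iota q.
Proof.
move=> sq qmin.
have qN y : q (- y) = - q y.
  apply/eqP; rewrite eq_le; apply/andP; split; last first.
    by rewrite lerNl; exact: sublinearN.
  have [||h ->|q' [sq' q'q q'N]] := @sublinear_push q [set y] (q y) sq.
  - move=> h k a b -> -> _ _; exists y => //.
    by rewrite (iotaD rf) scalerDl.
  - by exists y.
  - by [].
  by apply: le_trans (q'N y erefl); exact: qmin.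
have qD x y : q (x + y) = q x + q y.
  apply/eqP; rewrite eq_le sq.1/= -lerBrDr -qN.
  by have := sq.1 (x + y) (- y); rewrite addrK.
split=> // r x; have [r0|r0] := leP 0 r; first exact: sq.2.
have iN : iota (- - r) = - iota (- r).
  by apply: (addIr (iota (- r))); rewrite -(iotaD rf) !addNr iota0.
rewrite -[in LHS](opprK r) iN scaleNr qN sq.2 ?oppr_ge0 ?ltW//; ring.
Qed.

Lemma hahn_banach p : sublinear p ->
  exists g, real_linear iota g /\ forall x, g x <= p x.
Proof.
move=> /minimal_sublinear[q [sq qp qmin]]; exists q; split=> //.
exact: minimal_sublinear_linear.
Qed.

End sublinear.

Lemma rho_mono a b : 0 <= a -> 0 <= b -> (rho a <= rho b) = (a <= b).
Proof. by move=> a0 b0; rewrite -(iota_mono rf) !(iotaK rf). Qed.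

Lemma iota_inj : injective iota.
Proof.
by move=> a b ab; apply/eqP; rewrite eq_le -!(iota_mono rf) ab lexx.
Qed.

Lemma iota_ge0 a : (0 <= iota a) = (0 <= a).
Proof. by rewrite -iota0 (iota_mono rf). Qed.

Lemma rho_ge0 (z : K) : 0 <= z -> 0 <= rho z.
Proof. by move=> z0; rewrite -iota_ge0 (iotaK rf). Qed.

Lemma iota_lt a b : (iota a < iota b) = (a < b).
Proof. by rewrite !lt_neqAle (iota_mono rf) (inj_eq iota_inj). Qed.

Lemma rho_norm_scale (V : normedModType K) (r : R) (x : V) : 0 <= r ->
  rho `|iota r *: x| = r * rho `|x|.
Proof. by move=> r0; rewrite normrZ ger0_norm ?iota_ge0// (rhoZ rf). Qed.

Lemma sublinear_norm (V : normedModType K) : @sublinear V (fun x => rho `|x|).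
Proof.
split=> [x y|r x r0]; last exact: rho_norm_scale.
by rewrite -(rhoD rf) rho_mono// ?ler_normD ?addr_ge0.
Qed.

(** The norm is at least some [d > 0] on the translate of [H] by [- x0]. So
    a linear functional below the push of the norm along this translate is
    bounded by the norm, and larger by [d] on [H] than at [x0]. *)
Lemma separating_functional (X : normedModType K) (H : set X) x0 :
  closed_convex H -> H !=set0 -> ~ H x0 ->
  exists g d, [/\ real_linear iota g, forall x, `|g x| <= rho `|x|, 0 < d &
    forall h, H h -> g x0 + d <= g h].
Proof.
move=> cH [h0 Hh0] nHx0.
have [d d0 dP] : exists2 d : K, 0 < d & forall h, H h -> d <= `|x0 - h|.
  apply: contrapT => nd; apply: nHx0; move/closed_normP: cH.1; apply => e e0.
  apply: contrapT => nh; apply: nd; exists e => // h Hh.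
  have [//|he] := real_leP (gtr0_real e0) (normr_real (x0 - h)).
  by case: nh; exists h.

have rd0 : 0 < rho d.
  by rewrite -iota_lt iota0 (iotaK rf (ltW d0)).
have cH' : conic [set h - x0 | h in H].
  move=> _ _ a b [h Hh <-] [k Hk <-] a0 b0.
  have [w Hw wE] := convex_combE cH Hh Hk
    (etrans (iota_ge0 a) a0) (etrans (iota_ge0 b) b0).
  exists (w - x0); first by exists w.
  by rewrite (iotaD rf) [RHS]scalerBr -wE scalerDl !scalerBr opprD addrACA.
have [||q [sq qle qN]] :=
  @sublinear_push X (fun x => rho `|x|) _ (rho d) (@sublinear_norm X) cH'.
- by exists (h0 - x0), h0.
- by move=> _ [h Hh <-]; rewrite rho_mono ?(ltW d0)// distrC; exact: dP.
have [g [lg gq]] := hahn_banach sq; exists g, (rho d).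
have gN x : g (- x) = - g x.
  apply: (addIr (g x)); rewrite -lg.1 !addNr.
  by rewrite -[0 in LHS](scale0r (0 : X)) -iota0 lg.2 mul0r.
split=> //.
  move=> x; rewrite ler_norml lerNl -gN -[in X in X && _]normrN.
  by rewrite !(le_trans (gq _)).
move=> h Hh; have := gq (- (h - x0)); rewrite gN lg.1 gN => gl.
have := qN (h - x0) (ex_intro2 _ _ h Hh erefl); lra.
Qed.

Lemma real_linear_comb (V : lmodType K) (g : V -> R) (t : K) u v :
  real_linear iota g -> 0 <= t -> t <= 1 ->
  g (t *: u + (1 - t) *: v) = rho t * g u + (1 - rho t) * g v.
Proof.
move=> [gD gZ] t0 t1; rewrite gD -[t in t *: u](iotaK rf)// gZ; congr (_ + _).
have t'0 : 0 <= 1 - t by rewrite subr_ge0.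
rewrite -(iotaK rf t'0) gZ; congr (_ * _); apply: iota_inj.
rewrite (iotaK rf t'0); apply: (addIr t).
by rewrite subrK -[X in _ = _ + X](iotaK rf t0) -(iotaD rf) subrK (iota1 rf).
Qed.

End hahn_banach.

(** * Consequences of reflexivity *)

Lemma ultra_fmap (T S : Type) (f : T -> S) (U : set_system T) :
  UltraFilter U -> UltraFilter (f @ U).
Proof.
move=> UU; split=> [|G GF fG]; first exact: fmap_proper_filter.
apply/seteqP; split=> // A GA.
have [//|nA] := in_ultra_setVsetC (f @^-1` A) UU.
have [x []//] := filter_ex (filterI GA (fG (~` A) nA)).
Qed.

Section reflexivity.
Variables (R : realType) (K : numFieldType) (iota : R -> K) (rho : K -> R).
Hypothesis rf : real_form iota rho.
Variable X : normedModType K.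

Lemma real_form_archimedean (a : K) : 0 <= a -> exists n : nat, a < n%:R.
Proof.
move=> a0; have iotan n : iota n%:R = n%:R.
  elim: n => [|n IHn]; first exact: iota0 rf.
  by rewrite -!natr1 (iotaD rf) IHn (iota1 rf).
exists (Num.Def.archi_bound (rho a)); have := archi_boundP (rho_ge0 rf a0).
by rewrite -(iota_lt rf) (iotaK rf a0) iotan.
Qed.

Lemma lipschitz_halfspace (g : X -> R) a : real_linear iota g ->
  (forall x, `|g x| <= rho `|x|) ->
  closed_convex [set x | g x <= a] /\ closed_convex [set x | a <= g x].
Proof.
move=> lg gb.
have gB x y : g x - g y <= rho `|x - y|.
  apply: le_trans (gb (x - y)).
  have -> : g x = g (x - y) + g y by rewrite -lg.1 subrK.
  by rewrite addrK ler_norm.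
have near x y e : 0 < e -> `|x - y| < iota e -> g x - g y <= e.
  move=> e0 xy; apply: le_trans (gB x y) _.
  by rewrite -(iota_mono rf) (iotaK rf)// ltW.
have rt t : 0 <= t -> t <= 1 -> 0 <= rho t /\ 0 <= 1 - rho t.
  move=> t0 t1; split; first exact: (rho_ge0 rf).
  by rewrite subr_ge0 -(iota_mono rf) (iotaK rf)// (iota1 rf).
split; split.
- apply/closed_normP => x xP; apply/ler_addgt0Pr => e e0.
  have ie0 : 0 < iota e by rewrite -(iota0 rf) (iota_lt rf).
  have [b /= ba /(near _ _ _ e0)] := xP _ ie0; lra.
- move=> u v t t0 t1 /= ua va; rewrite (real_linear_comb rf)//.
  have [r0 r1] := rt t t0 t1.
  have := ler_wpM2l r0 ua; have := ler_wpM2l r1 va; lra.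
- apply/closed_normP => x xP /=; apply/ler_addgt0Pr => e e0.
  have ie0 : 0 < iota e by rewrite -(iota0 rf) (iota_lt rf).
  have [b /= ba] := xP _ ie0; rewrite distrC.
  move=> /(near _ _ _ e0); lra.
- move=> u v t t0 t1 /= ua va; rewrite (real_linear_comb rf)//.
  have [r0 r1] := rt t t0 t1.
  have := ler_wpM2l r0 ua; have := ler_wpM2l r1 va; lra.
Qed.

Lemma real_form_separation : separation_property X.
Proof.
move=> H x0 cH nHx0; have [H0|/set0P H0] := eqVneq H set0.
  exists set0, setT.
  split; [exact: closed_convex0|exact: closed_convexT|by right|by []|].
  by rewrite H0.
have [g [d [lg gb d0 gH]]] := separating_functional rf cH H0 nHx0.
exists [set x | g x0 + d / 2 <= g x], [set x | g x <= g x0 + d / 2]; split.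
- by have [] := lipschitz_halfspace (g x0 + d / 2) lg gb.
- by have [] := lipschitz_halfspace (g x0 + d / 2) lg gb.
- by move=> y /=; have [|/ltW] := leP (g x0 + d / 2) (g y); [left|right].
- move=> /=; lra.
- move=> y /gH /=; lra.
Qed.

Lemma dual_linear (f : dual X) : linear f.
Proof. by have /asboolP[] := valP f. Qed.

Lemma dual_of_bounded (f : {linear X -> K^o}) (M : K) :
  (forall x, `|f x| <= M * `|x|) -> exists F : dual X, F = f :> (X -> K^o).
Proof.
move=> fM; have M0 : 0 < `|M| + 1 by rewrite ltr_wpDl.
suff fP : (f : X -> K^o) \in @dual_pred K X by exists (Dual fP).
apply/asboolP; split; first by move=> a x y; exact: linearP.
move=> x; apply/cvgrPdist_lt => e e0.
have : nbhs x (ball x (e / (`|M| + 1))) by apply: nbhsx_ballx; rewrite divr_gt0.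
apply: filterS => y; rewrite -ball_normE /= ltr_pdivlMr// => xy.
rewrite -linearB; apply: le_lt_trans xy; rewrite mulrC.
have [xy0|xy0] := eqVneq (x - y) 0; first by rewrite xy0 linear0 !normr0 mulr0.
apply: le_trans (fM _) _; rewrite ler_pM2r ?normr_gt0//.
have Mr : M \is Num.real.
  have := le_trans (normr_ge0 _) (fM (x - y)); rewrite pmulr_lge0 ?normr_gt0//.
  exact: ger0_real.
by rewrite (le_trans (real_ler_norm Mr))// lerDl.
Qed.

Lemma dual_bounded (f : dual X) :
  exists2 M : K, 0 <= M & forall x, `|f x| <= M * `|x|.
Proof.
have /asboolP[lf cf] := valP f.
have [F FE] := linear_pack lf.
have F0 : F 0 = 0 by exact: linear0.
have /cvgrPdist_lt/(_ 1 ltr01)/nbhs_normP[d /= d0 dP] := cf 0.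
rewrite /= in d0; have d20 : 0 < d / 2 by rewrite divr_gt0.
exists (2 / d); first by rewrite divr_ge0// ltW.
move=> x; have [->|x0] := eqVneq x 0.
  by rewrite -FE F0 !normr0 mulr0.
have nx0 : 0 < `|x| by rewrite normr_gt0.
have c0 : 0 < d / 2 / `|x| by rewrite divr_gt0.
have := dP (d / 2 / `|x| *: x).
rewrite /ball_ /= sub0r normrN normrZ (gtr0_norm c0) divfK ?gt_eqF//.
rewrite ltr_pdivrMr// ltr_pMr// ltr1n -FE F0 sub0r normrN linearZ /= normrZ.
rewrite (gtr0_norm c0) -ltr_pdivlMl// mulr1 => /(_ isT)/ltW/le_trans; apply.
by rewrite !invf_div mulrC mulrAC.
Qed.

(** The infimum of the bounds is itself a bound. *)
Lemma operator_normP (f : dual X) : is_operator_norm f (operator_norm f).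
Proof.
suff [M MP] : exists M, is_operator_norm f M.
  by rewrite /operator_norm; apply: xgetPex; exists M.
pose A := [set r | 0 <= r /\ forall x, `|f x| <= iota r * `|x|].
have A0 : A !=set0.
  have [M M0 MP] := dual_bounded f.
  exists (rho M); split; first exact: (rho_ge0 rf).
  by move=> x; rewrite (iotaK rf).
have Alb : lbound A 0 by move=> r [].
exists (iota (inf A)); split.
- by rewrite (iota_ge0 rf); apply: lb_le_inf.
- move=> x; have [->|x0] := eqVneq x 0.
    have [F FE] := linear_pack (dual_linear f).
    by rewrite -FE linear0 !normr0 mulr0.
  have nx0 : 0 < `|x| by rewrite normr_gt0.
  rewrite -ler_pdivrMr// -(iotaK rf (_ : 0 <= `|f x| / `|x|)) ?divr_ge0//.
  rewrite (iota_mono rf); apply: lb_le_inf => // r [r0 rP].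
  by rewrite -(iota_mono rf) (iotaK rf) ?divr_ge0// ler_pdivrMr.
- move=> M' M'0 M'P; rewrite -(iotaK rf M'0) (iota_mono rf).
  apply: inf_le Alb _; split; first exact: (rho_ge0 rf).
  by move=> x; rewrite (iotaK rf).
Qed.

Lemma operator_norm_scale (j : K) (f : dual X) : `|j| = 1 ->
  operator_norm (j *: f) <= operator_norm f.
Proof.
move=> j1; have [f0 fP _] := operator_normP f.
have [_ _] := operator_normP (j *: f).
apply=> // x; apply: le_trans (fP x); rewrite [X in `|X|](_ : _ = j * f x)//.
by rewrite normrM j1 mul1r.
Qed.

(** Along an ultrafilter finer than the given one, each functional converges,
    and its limit is a bounded linear function of the functional. By reflexivity
    it is the evaluation at a point [x]. If a closed convex member of the filter
    did not contain [x], a functional separating them would have a limit other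
    than its value at [x]. *)
Lemma reflexive_weak_cluster : reflexive_space X -> weak_cluster_property X.
Proof.
move=> reflX F FF [B FB [M BM]].
have [U [UU FU]] := ultraFilterLemma FF.
have UB := FU _ FB.
have M0 : 0 <= M.
  by have [x /BM] := filter_ex FB; apply: le_trans.
pose N (f : dual X) : R := rho (operator_norm f * M).
have N0 (f : dual X) : 0 <= operator_norm f * M.
  by rewrite mulr_ge0//; have [] := operator_normP f.
have /choice[Phi PhiP] : forall f : dual X, exists r : R,
    `|r| <= N f /\ (fun x : X => rho (f x)) @ U --> r.
  move=> f; pose G := (fun x : X => rho (f x)) @ U.
  have GU : UltraFilter G by exact: ultra_fmap.
  have UN : U [set x : X | (rho (f x) : R) \in `[- N f, N f]].
    apply: filterS UB => x /BM xM /=; rewrite in_itv /= -ler_norml.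
    rewrite -(iota_mono rf) (iotaK rf)//; apply: le_trans (rho_norm rf _) _.
    have [f0 fP _] := operator_normP f.
    by apply: le_trans (fP x) _; rewrite ler_wpM2l.
  have := @segment_compact R (- N f) (N f).
  rewrite compact_ultra => /(_ G GU UN)[].
  by move=> r [/=]; rewrite in_itv /= -ler_norml => rN Gr; exists r.
have PhiU (f : dual X) r : (fun x : X => rho (f x)) @ U --> r -> Phi f = r.
  by move=> fr; apply: cvg_unique (PhiP f).2 fr; exact: Rhausdorff.
(* only the real parts are shown to converge; phi lifts their limits *)
have Philin : real_linear iota Phi.
  split=> [f g|r f]; apply: PhiU.
    rewrite (_ : (fun x => _) = (fun x => rho (f x) + rho (g x))).
      by apply: cvgD; [exact: (PhiP f).2|exact: (PhiP g).2].
    by apply/funext => x; rewrite -(rhoD rf).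
  rewrite (_ : (fun x => _) = (fun x => r * rho (f x))).
    by apply: cvgMr; exact: (PhiP f).2.
  by apply/funext => x; rewrite -(rhoZ rf).
have [phi [j [phiE j1 phiB]]] := real_linear_lift rf Philin.
have [|x xP] := reflX phi.
  exists (M *+ 2) => f; apply: le_trans (phiB f) _.
  have b (g : dual X) : iota `|Phi g| <= operator_norm g * M.
    by rewrite -[leRHS](iotaK rf)// (iota_mono rf); exact: (PhiP g).1.
  rewrite mulr2n mulrDl [M * _]mulrC lerD//.
  by apply: le_trans (b _) _; rewrite ler_wpM2r// operator_norm_scale.
exists x => C cC FC; have UC := FU _ FC; apply: contrapT => nCx.
have [g [d [lg gb d0 gC]]] := separating_functional rf cC (filter_ex FC) nCx.
have [f [k [fE k1 fB]]] := real_linear_lift rf lg.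
have [|f' f'E] := @dual_of_bounded f 2.
  move=> y; apply: le_trans (fB y) _; rewrite mulr_natl mulr2n.
  have b z : iota `|g z| <= `|z|.
    by rewrite -[leRHS](iotaK rf)// (iota_mono rf).
  by rewrite lerD//; apply: le_trans (b _) _; rewrite normrZ k1 mul1r.
have Phig : Phi f' = g x by rewrite -phiE xP f'E fE.
have /cvgrPdist_lt/(_ d d0) := (PhiP f').2; rewrite Phig f'E => near.
have [y [/= yd /gC gy]] := filter_ex (filterI near UC).
by move: yd; rewrite fE distrC ltr_norml => /andP[_]; lra.
Qed.

End reflexivity.

(** * Envelopes of closures of directed unions *)

Lemma minimal_stable_dentable (R : realType) (K : numFieldType)
    (X : normedModType K) Y C M :
  real_or_complex R K -> reflexive_space X ->
  separable_space X \/ locally_uniformly_convex X ->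
  norm_bounded C M -> @minimal_stable_set K X Y C -> dentable_envelope C.
Proof.
move=> hK reflX [sepX|lucX] CM minC; last exact: LUC_envelope minC.
have [iota [rho rf]] := real_or_complex_form hK.
apply: dentable_stable_envelope CM minC => E e E0 cE EM e0.
exact: (separable_dentable (real_form_archimedean rf)
  (reflexive_weak_cluster rf reflX) (real_form_separation rf (X := X))
  sepX E0 cE EM e0).
Qed.

(** A nonlinear projection onto the envelope: the fixed point is found in a
    minimal stable set of points whose orbits remain close to [x]. *)
Lemma Env_near (R : realType) (K : numFieldType) (X : normedModType K) Y
    (x : X) d :
  real_or_complex R K -> reflexive_space X ->
  separable_space X \/ locally_uniformly_convex X -> 0 < d ->
  near_identity Y [set T | `|T x - x| <= d] ->
  exists2 z, Env Y z & `|z - x| <= d.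
Proof.
move=> hK reflX sepluc d0 xd.
have [iota [rho rf]] := real_or_complex_form hK.
have wc := reflexive_weak_cluster rf reflX.
have C0x : orbit_within Y x d x.
  by move=> e e0; apply: filterS xd => T /= /le_trans; apply; rewrite lerDl ltW.
have C0M : norm_bounded (orbit_within Y x d) (d + `|x|).
  move=> c /orbit_within_ball cx; rewrite -(subrK x c).
  by rewrite (le_trans (ler_normD _ _))// lerD2r.
have [C CC0 minC] := minimal_stable wc (ex_intro _ x C0x)
  (@orbit_within_closed_convex _ _ Y x d) C0M (@orbit_within_stable _ _ Y x d).
have [[z Cz] cC sC _] := minC.
have CM : norm_bounded C (d + `|x|) by move=> c /CC0/C0M.
exists z; last exact/orbit_within_ball/CC0.
apply: (dentable_stable_Env wc cC CM sC _ Cz).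
exact: (minimal_stable_dentable hK reflX sepluc CM minC).
Qed.

Theorem corollary3p3 (R : realType) (K : numFieldType)
    (hK : real_or_complex R K) (X : completeNormedModType K)
    (X_reflexive : reflexive_space X)
    (X_separable_or_LUC : separable_space X \/ locally_uniformly_convex X)
    (I : Type) (le : I -> I -> Prop) (Yi : I -> set X)
    (Yi_directed : directed_family le Yi)
    (Y : set X) (YE : Y = closure (\bigcup_i Yi i)) :
  Env Y = closure (\bigcup_i Env (Yi i)).
Proof.
apply/seteqP; split=> x.
  move=> /Env_near_identity xP; apply/closure_normP => e e0.
  have e20 : 0 < e / 2 by rewrite divr_gt0.
  have := xP _ e20; rewrite YE => /(near_identity_directed Yi_directed)[i xi].
  have [z zE zx] := Env_near hK X_reflexive X_separable_or_LUC e20 xi.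
  exists z; first by exists i.
  by rewrite distrC (le_lt_trans zx)// ltr_pdivrMr// ltr_pMr// ltr1n.
move=> /closure_normP xP; apply: near_identity_Env => e e0.
have e30 : 0 < e / 3 by rewrite divr_gt0.
have [a [i _ /Env_near_identity/(_ _ e30) ai] xa] := xP _ e30.
have YiY : Yi i `<=` Y by rewrite YE => y Yiy; apply: subset_closure; exists i.
apply: filterS2 (near_identity_sub YiY ai) (near_identity_isometry Y).
move=> T /= Ta [Tiso _].
have -> : T x - x = T (x - a) + ((T a - a) + (a - x)).
  by rewrite linearB subrKA addrA subrK.
have -> : e = e / 3 + (e / 3 + e / 3) by field.
rewrite (le_trans (ler_normD _ _))// Tiso lerD//; first exact: ltW.
by rewrite (le_trans (ler_normD _ _))// lerD// distrC ltW.
Qed.
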